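(* Let $c>0$, $\pi\in[0,1]$, $\lambda_0:=(1-\pi)/c^2$, $\lambda_1:=\pi/c^2$. Let $D\sim\mathrm{Skellam}(\lambda_0,\lambda_1)$, let $P_\infty:=\mathcal L(D)$ and write $p_\infty(d):=\mathbb P(D=d)$. Let $Q_\infty$ be the law of $1+D$, so $Q_\infty(d)=p_\infty(d-1)$. Then for every $\varepsilon\ge0$, $$\delta_{Q_\infty\|P_\infty}(\varepsilon)=\sum_{d\in\mathbb Z}\bigl(p_\infty(d-1)-e^{\varepsilon}p_\infty(d)\bigr)_+.$$ If $\pi\in(0,1)$, then $\lambda_0,\lambda_1>0$ and $p_\infty(d)>0$ for all $d\in\mathbb Z$, hence there is no two-sided support-mismatch floor (in contrast with the Poisson-shift experiment). At boundary compositions $\pi\in\{0,1\}$ one of $\lambda_0,\lambda_1$ vanishes and the limit reduces to the Poisson-shift experiment.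
   Context: $\mathrm{Skellam}(\lambda_0,\lambda_1)$ is the law of $X-Y$ with $X\sim\mathrm{Poi}(\lambda_0)$, $Y\sim\mathrm{Poi}(\lambda_1)$ independent ($\mathrm{Poi}(0)$ is the point mass at $0$). The Poisson-shift experiment is the pair $(\mathrm{Poi}(\lambda),1+\mathrm{Poi}(\lambda))$ with $\lambda=c^{-2}$, where $1+\mathrm{Poi}(\lambda)$ is the law of $1+J$, $J\sim\mathrm{Poi}(\lambda)$. $(u)_+:=\max\{u,0\}$. For probability measures $P,Q$ and $\varepsilon\ge0$, $\delta_{Q\|P}(\varepsilon):=\sup_A\{Q(A)-e^{\varepsilon}P(A)\}$ over measurable sets $A$, and the two-sided curve is $\delta_{\mathrm{two}}(\varepsilon):=\max\{\delta_{Q\|P}(\varepsilon),\delta_{P\|Q}(\varepsilon)\}$. A two-sided support-mismatch floor means a positive lower bound on $\delta_{\mathrm{two}}(\varepsilon)$, uniform in $\varepsilon$, arising from a set that has positive probability under one of $P,Q$ and zero probability under the other; for the Poisson-shift experiment, the point $0$ gives $\delta_{\mathrm{two}}(\varepsilon)\ge e^{-\lambda}$ for all $\varepsilon\ge0$. *)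

(* Defs.v *)
From HB Require Import structures.
From mathcomp Require Import all_boot all_order all_algebra.
From mathcomp Require Import all_classical all_reals all_analysis.

Set Implicit Arguments.
Unset Strict Implicit.
Unset Printing Implicit Defensive.

Import Order.TTheory GRing.Theory Num.Theory.
Import numFieldNormedType.Exports.

Local Open Scope classical_set_scope.
Local Open Scope ring_scope.

(* Every subset of int is measurable, as in the library for nat. *)
HB.instance Definition _ := isPointed.Build int 0.
HB.instance Definition _ := @isMeasurable.Build default_measure_display
  int discrete_measurable discrete_measurable0
  discrete_measurableC discrete_measurableU.

Definition succz (z : int) : int := 1 + z.
Definition reflz (z : int) : int := 1 - z.
Definition subz (xy : nat * nat) : int := xy.1%:Z - xy.2%:Z.

Lemma measurable_succz : measurable_fun [set: int] succz.
Proof. by []. Qed.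

Lemma measurable_reflz : measurable_fun [set: int] reflz.
Proof. by []. Qed.

Lemma measurable_Posz : measurable_fun [set: nat] Posz.
Proof. by []. Qed.

Lemma measurable_subz : measurable_fun [set: nat * nat] subz.
Proof.
move=> _ Y _; rewrite setTI.
have -> : subz @^-1` Y =
  \bigcup_i \bigcup_(j in [set j | Y (subz (i, j))]) ([set i] `*` [set j]).
  apply/seteqP; split => [[i j] /= Yij|[i j] [i' _ [j' /= Yij [/= -> ->]]]] //.
  by exists i => //; exists j.
apply: bigcupT_measurable => i; apply: bigcup_measurable => j _.
exact: measurableX.
Qed.

HB.instance Definition _ := isMeasurableFun.Build _ _ _ _ succz measurable_succz.
HB.instance Definition _ := isMeasurableFun.Build _ _ _ _ reflz measurable_reflz.
HB.instance Definition _ := isMeasurableFun.Build _ _ _ _ Posz measurable_Posz.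
HB.instance Definition _ := isMeasurableFun.Build _ _ _ _ subz measurable_subz.

(* The library's poisson_prob carries a nat argument that it does not use, and
   poisson_prob 0 _ is the point mass at 0. *)
Definition poisson (R : realType) (lam : R) : probability nat R :=
  poisson_prob lam 0%N.

Definition poissonZ (R : realType) (lam : R) : probability int R :=
  distribution (poisson lam) Posz.

Definition shifted_poissonZ (R : realType) (lam : R) : probability int R :=
  distribution (poissonZ lam) succz.

(* Independence of the two Poisson variables is encoded by the product
   measure, under which the coordinates are independent. *)
Definition skellam (R : realType) (lam0 lam1 : R) : probability int R :=
  distribution (poisson lam0 \x poisson lam1)%E subz.

Section privacy_curves.
Context d (T : measurableType d) (R : realType).
Implicit Types (P Q : probability T R) (eps : R) (A : set T).
Local Open Scope ereal_scope.

(* delta_{Q || P}(eps) *)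
Definition privacy_curve Q P eps : \bar R :=
  ereal_sup [set Q A - (expR eps)%:E * P A | A in measurable].

Definition two_sided_curve P Q eps : \bar R :=
  maxe (privacy_curve Q P eps) (privacy_curve P Q eps).

(* k is a two-sided floor arising from A: a positive lower bound of the
   two-sided curve, uniform in eps, that does not exceed the mass which one of
   the two measures gives to a set A that is null for the other. *)
Definition support_mismatch_floor P Q A (k : R) : Prop :=
  [/\ measurable A,
      (P A = 0 /\ k%:E <= Q A) \/ (Q A = 0 /\ k%:E <= P A),
      (0 < k)%R &
      forall eps, (0 <= eps)%R -> k%:E <= two_sided_curve P Q eps].

End privacy_curves.

(* Main.v *)
Require Import Defs.
From HB Require Import structures.
From mathcomp Require Import all_boot all_order all_algebra.
From mathcomp Require Import all_classical all_reals all_analysis.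

Set Implicit Arguments.
Unset Strict Implicit.
Unset Printing Implicit Defensive.

Import Order.TTheory GRing.Theory Num.Theory.
Import numFieldNormedType.Exports.

Local Open Scope classical_set_scope.
Local Open Scope ring_scope.

(* On a countable discrete space every measure is the sum of its atoms, and
   Q A - e^eps P A is largest when A collects the atoms at which
   Q {x} > e^eps P {x}; this gives the formula for the curve.  For
   0 < comp < 1, writing d = i - j with i, j >= 0 bounds P {d} below by a
   product of two positive Poisson masses, so only the empty set is null.  At
   the boundary one Poisson law is a point mass; for comp = 1 the involution
   z |-> 1 - z maps the pair (P, Q) to the Poisson-shift pair in reverse order,
   which the two-sided curve does not see. *)

(** * Measures and privacy curves as sums over atoms *)

Section countable_sums.
Local Open Scope ereal_scope.

(** An injection [f] of [A] into [nat] cuts [A] into fibres [G n], each a single atom for [n] in the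
    image. Countable additivity over the image of [f], reindexed back along [f], gives the sum over
    [A]. *)
Lemma measure_esum d (T : measurableType d) (R : realType)
    (mu : {measure set T -> \bar R}) (A : set T) :
  countable A -> (forall x : T, measurable [set x]) ->
  mu A = \esum_(x in A) mu [set x].
Proof.
move=> /countable_injP[f injA] m1.
pose G n := [set x | A x /\ f x = n].
have fG x : A x -> G (f x) = [set x].
  move=> Ax; apply/seteqP; split=> [y [Ay fyx]|y ->] //=.
  by apply: injA; rewrite ?inE.
have -> : mu A = mu (\bigcup_(n in f @` A) G n).
  congr (mu _); apply/seteqP; split=> [x Ax|x [n _ []]//].
  by exists (f x) => //; exists x.
rewrite measure_bigcup; last 2 first.
- by move=> _ [x Ax <-]; rewrite fG.
- by move=> i j _ _ [x [[_ <-] [_ <-]]].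
rewrite nneseries_esum// set_mem_set esum_image//.
by apply: eq_esum => x Ax; rewrite fG.
Qed.

Lemma privacy_curve_esum d (T : measurableType d) (R : realType)
    (Q P : probability T R) (eps : R) :
  countable [set: T] -> (forall A : set T, measurable A) ->
  privacy_curve Q P eps =
  \esum_(x in [set: T])
    (Num.max (fine (Q [set x]) - expR eps * fine (P [set x])) 0)%R%:E.
Proof.
move=> cT mT; pose m x : R :=
  Num.max (fine (Q [set x]) - expR eps * fine (P [set x]))%R 0%R.
rewrite -[RHS]/(\esum_(x in [set: T]) (m x)%:E).
have cA (A : set T) : countable A.
  by apply: sub_countable cT; exact: subset_card_le.
have m0 x : 0 <= (m x)%:E by rewrite lee_fin le_max lexx orbT.
(* Scaling by a bundled nonnegative real makes e^eps P a measure in its own right, so that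
   [measure_esum] applies to it as it does to [Q]. *)
pose e : {nonneg R} := NngNum (expR_ge0 eps).
pose eP : {measure set T -> \bar R} := mscale e P.
have ePE A : (expR eps)%:E * P A = eP A by [].
have fineP (mu : probability T R) A : (fine (mu A))%:E = mu A.
  by rewrite fineK// fin_num_measure.
have QE A : Q A = \esum_(x in A) Q [set x] by exact: measure_esum.
(* Finiteness of [eP A] allows it to be moved across in the extended reals; both inequalities then
   compare sums of nonnegative terms, without subtracting any series. *)
have ePfin A : eP A \is a fin_num by rewrite -ePE fin_numM// fin_num_measure.
have sumE A : \esum_(x in A) (m x)%:E + eP A =
    \esum_(x in A) ((m x)%:E + eP [set x]).
  by rewrite (measure_esum eP (cA A))// esumD.
apply/eqP; rewrite eq_le; apply/andP; split.
- apply: ge_ereal_sup => _ [A mA <-].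
  rewrite ePE leeBlDr//.
  apply: (@le_trans _ _ (\esum_(x in A) (m x)%:E + eP A)); last first.
    rewrite leeD2r// esum_mkcond; apply: le_esum => x _.
    by case: ifP.
  rewrite sumE QE; apply: le_esum => x _.
  rewrite -ePE -(fineP Q) -(fineP P) -EFinM -EFinD lee_fin.
  by rewrite -lerBlDr le_max lexx.
- apply: ereal_sup_ubound.
  (* The supremum is attained here: off this set [m] vanishes, and on it [m x] is the difference
     itself, so adding [eP] back returns exactly [Q]. *)
  exists [set x | (0 < fine (Q [set x]) - expR eps * fine (P [set x]))%R] => //.
  set A := [set x | _].
  have -> : \esum_(x in [set: T]) (m x)%:E = \esum_(x in A) (m x)%:E.
    rewrite [RHS]esum_mkcond; apply: eq_esum => x _; case: ifPn => //.
    rewrite notin_setE /= => /negP; rewrite -leNgt => /max_idPr.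
    by rewrite /m => ->.
  rewrite ePE -[RHS](addeK _ (ePfin A)) sumE QE; congr (_ - _).
  apply: eq_esum => x Ax.
  rewrite -ePE -(fineP Q) -(fineP P) -EFinM -EFinD /m max_l ?subrK//.
  exact: ltW.
Qed.

End countable_sums.

(** * Invariance of the curves *)

Section privacy_curve_theory.
Context d (T : measurableType d) (R : realType).
Implicit Types (P Q : probability T R) (eps : R).
Local Open Scope ereal_scope.

Lemma two_sided_curveC P Q eps :
  two_sided_curve P Q eps = two_sided_curve Q P eps.
Proof. exact: maxC. Qed.

Lemma eq_privacy_curve Q P Q' P' eps :
  (forall A, measurable A -> Q A = Q' A) ->
  (forall A, measurable A -> P A = P' A) ->
  privacy_curve Q P eps = privacy_curve Q' P' eps.
Proof.
move=> QQ' PP'; congr ereal_sup.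
by apply: eq_imagel => A mA; rewrite QQ'// PP'.
Qed.

(** Taking preimages under [f] permutes the measurable sets, so both suprema run over the same
    values. *)
Lemma privacy_curve_distribution_involutive Q P (f : {mfun T >-> T}) eps :
  involutive f ->
  privacy_curve (distribution Q f) (distribution P f) eps =
  privacy_curve Q P eps.
Proof.
move=> fK.
have fKI A : f @^-1` (f @^-1` A) = A.
  by rewrite -comp_preimage; apply/seteqP; split=> x /=; rewrite fK.
congr ereal_sup; apply/seteqP; split=> _ [A mA <-].
  by exists (f @^-1` A); rewrite //= -[_ @^-1` _]setTI; exact: measurable_funPT.
exists (f @^-1` A); first by rewrite -[_ @^-1` _]setTI; exact: measurable_funPT.
by rewrite -[in RHS](fKI A).
Qed.

Lemma eq_two_sided_curve P Q P' Q' eps :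
  (forall A, measurable A -> P A = P' A) ->
  (forall A, measurable A -> Q A = Q' A) ->
  two_sided_curve P Q eps = two_sided_curve P' Q' eps.
Proof. by move=> PP' QQ'; congr Order.max; exact: eq_privacy_curve. Qed.

Lemma two_sided_curve_distribution_involutive P Q (f : {mfun T >-> T}) eps :
  involutive f ->
  two_sided_curve (distribution P f) (distribution Q f) eps =
  two_sided_curve P Q eps.
Proof.
by move=> fK; congr Order.max; exact: privacy_curve_distribution_involutive.
Qed.

End privacy_curve_theory.

(** * Poisson and Skellam masses *)

Section poisson_theory.
Context {R : realType}.
Implicit Types lam : R.
Local Open Scope ereal_scope.

Lemma poisson_set1 lam k : (0 < lam)%R ->
  poisson lam [set k] = (poisson_pmf lam k)%:E.
Proof.
move=> lam0; rewrite /poisson /= /poisson_prob lam0.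
apply: esum_set1.
by rewrite lee_fin poisson_pmf_ge0.
Qed.

Lemma poisson0E (A : set nat) : poisson (0 : R) A = \d_0%N A.
Proof. by rewrite /poisson /= /poisson_prob ltxx. Qed.

Lemma poisson_set1_gt0 lam k : (0 < lam)%R -> 0 < poisson lam [set k].
Proof.
move=> lam0; rewrite poisson_set1// lte_fin /poisson_pmf lam0.
by rewrite mulr_gt0 ?expR_gt0// divr_gt0 ?exprn_gt0.
Qed.

Let measurable_subz_preimage (B : set int) : measurable (subz @^-1` B).
Proof. by rewrite -[_ @^-1` _]setTI; exact: measurable_subz. Qed.

(** The product measure integrates the masses of the x-sections. With a Dirac second factor, such a
    mass only tests whether 0 lies in the section, that is, whether x - 0 is in [B]. *)
Lemma skellam_r0 lam (B : set int) : skellam lam 0 B = poissonZ lam B.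
Proof.
rewrite /skellam /poissonZ /distribution /pushforward /= /product_measure1.
transitivity (\int[poisson lam]_x (\1_(Posz @^-1` B) x)%:E).
  apply: eq_integral => x _; rewrite /= poisson0E diracE mem_xsection indicE.
  congr (_%:R)%:E; congr nat_of_bool.
  by apply/idP/idP; rewrite !inE /= /subz /= subr0.
by rewrite integral_indic// setIT.
Qed.

(** Now the outer measure is the Dirac one: the integral is its integrand at 0, the mass of the
    section of all y with 0 - y in [B]. *)
Lemma skellam_0l lam (B : set int) :
  skellam 0 lam B = poissonZ lam (-%R @^-1` B).
Proof.
rewrite /skellam /poissonZ /distribution /pushforward /= /product_measure1.
rewrite (@eq_measure_integral _ _ _ _ (\d_0%N)); last first.
  by move=> A _ _; exact: poisson0E.
rewrite integral_dirac// diracT mul1e /=.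
congr (poisson lam _); apply/seteqP; split=> x.
  by rewrite /xsection /= inE /= /subz /= sub0r.
by rewrite /xsection /= inE /= /subz /= sub0r.
Qed.

Lemma skellam_gt0 lam0 lam1 (d : int) : (0 < lam0)%R -> (0 < lam1)%R ->
  0 < skellam lam0 lam1 [set d].
Proof.
move=> l0 l1.
have [ij ijd] : exists ij, subz ij = d.
  case: d => n; first by exists (n, 0%N); rewrite /subz subr0.
  (* [Negz n] stands for -(n + 1), hence the successor. *)
  by exists (0%N, n.+1); rewrite /subz sub0r NegzE.
have mij : measurable ([set ij.1] `*` [set ij.2]) by exact: measurableX.
apply: (@lt_le_trans _ _
  ((poisson lam0 \x poisson lam1) ([set ij.1] `*` [set ij.2]))).
  rewrite product_measure1E//.
  by apply: mule_gt0; exact: poisson_set1_gt0.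
apply: (@le_measure _ _ _ (poisson lam0 \x poisson lam1) _ (subz @^-1` [set d]));
  rewrite ?inE//.
by case: ij ijd {mij} => i j <- [i' j'] [/= -> ->].
Qed.

Lemma shifted_poissonZ_set0 lam : shifted_poissonZ lam [set 0%R] = 0.
Proof.
rewrite -(measure0 (poisson lam)); congr (poisson lam _).
by apply/seteqP; split=> // n /eqP; rewrite /succz.
Qed.

Lemma poissonZ_set0 lam : (0 < lam)%R ->
  poissonZ lam [set 0%R] = (expR (- lam))%:E.
Proof.
move=> lam0; transitivity (poisson lam [set 0%N]).
  by congr (poisson lam _); apply/seteqP; split=> [n [->]|n ->].
by rewrite poisson_set1// /poisson_pmf lam0 expr0 fact0 invr1 !mul1r.
Qed.

Lemma poisson_shift_floor lam : (0 < lam)%R ->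
  support_mismatch_floor (poissonZ lam) (shifted_poissonZ lam)
    [set 0%R] (expR (- lam)).
Proof.
move=> lam0; split=> //; rewrite ?expR_gt0//.
  by right; rewrite shifted_poissonZ_set0 poissonZ_set0.
(* The useful direction subtracts e^eps times the shifted law; that law gives 0 no mass, so at the
   witness {0} the bound is the same for every [eps]. *)
move=> eps _; rewrite /two_sided_curve le_max; apply/orP; right.
apply: ereal_sup_ubound; exists [set 0%R] => //.
by rewrite shifted_poissonZ_set0 poissonZ_set0// mule0 sube0.
Qed.

End poisson_theory.

(** Under full support a null set is empty, so the other measure vanishes on it too and [k] cannot
    be positive. *)
Lemma no_support_mismatch_floor d (T : measurableType d) (R : realType)
    (P Q : probability T R) (A : set T) (k : R) :
  (forall x : T, measurable [set x]) ->
  (forall x, 0 < P [set x])%E -> (forall x, 0 < Q [set x])%E ->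
  ~ support_mismatch_floor P Q A k.
Proof.
move=> m1 P0 Q0 [mA PQA k0 _].
have A0 (mu : probability T R) :
    (forall x, 0 < mu [set x])%E -> mu A = 0%E -> A = set0.
  move=> mu0 muA; rewrite -subset0 => x Ax; have := mu0 x.
  rewrite ltNge => /negP; apply; rewrite -muA; apply: le_measure; rewrite ?inE//.
  by move=> _ ->.
have : (k%:E <= 0)%E.
  by case: PQA => -[/A0 -> //]; rewrite measure0.
by rewrite lee_fin leNgt k0.
Qed.

(** * The Skellam shift at interior and boundary compositions *)

Theorem corollary4p6 (R : realType) (c comp lam0 lam1 : R)
    (hc : 0 < c) (hcomp : 0 <= comp <= 1)
    (hlam0 : lam0 = (1 - comp) / c ^+ 2) (hlam1 : lam1 = comp / c ^+ 2)
    (dsp : measure_display) (T : measurableType dsp) (Pr : probability T R)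
    (D : {RV Pr >-> int})
    (hD : forall B : set int, distribution Pr D B = skellam lam0 lam1 B) :
  let Pinf : probability int R := distribution Pr D in
  let Qinf : probability int R := distribution Pr (succz \o D) in
  let p (d : int) : R := fine (Pr [set t | D t = d]) in
  let lam : R := c ^- 2 in
  [/\
    (forall d : int, Qinf [set d] = (p (d - 1))%:E),
    (forall eps : R, 0 <= eps ->
      privacy_curve Qinf Pinf eps =
      (\esum_(d in [set: int])
         (Num.max (p (d - 1) - expR eps * p d) 0)%:E)%E),
    (0 < comp < 1 ->
      [/\ 0 < lam0, 0 < lam1, forall d : int, 0 < p d &
          ~ exists (A : set int) (k : R),
              support_mismatch_floor Pinf Qinf A k]),
    support_mismatch_floor (poissonZ lam) (shifted_poissonZ lam)
      [set 0] (expR (- lam)) &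
    ((comp = 0 ->
       [/\ lam0 = lam, lam1 = 0,
           forall B : set int, Pinf B = poissonZ lam B &
           forall B : set int, Qinf B = shifted_poissonZ lam B]) /\
     (comp = 1 ->
       [/\ lam0 = 0, lam1 = lam,
           forall B : set int, distribution Qinf reflz B = poissonZ lam B &
           forall B : set int,
             distribution Pinf reflz B = shifted_poissonZ lam B]) /\
     (comp = 0 \/ comp = 1 ->
       forall eps : R, 0 <= eps ->
         two_sided_curve Pinf Qinf eps =
         two_sided_curve (poissonZ lam) (shifted_poissonZ lam) eps))].
Proof.
move=> Pinf Qinf p lam.
have lam_gt0 : 0 < lam by rewrite invr_gt0 exprn_gt0.
have cZ : countable [set: int] by exact: countableP.
have QE (B : set int) : Qinf B = Pinf (succz @^-1` B) by [].
have PS (B : set int) : Pinf B = skellam lam0 lam1 B := hD B.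
have pE d : Pinf [set d] = (p d)%:E.
  have Pfin : Pinf [set d] \is a fin_num by rewrite fin_num_measure.
  by rewrite -[LHS](fineK Pfin).
have Q1 d : Qinf [set d] = (p (d - 1))%:E.
  rewrite QE -pE; congr (Pinf _); apply/seteqP; split=> x /=.
    by rewrite /succz => <-; rewrite addrAC subrr add0r.
  by rewrite /succz => ->; rewrite addrC subrK.
have side0 : comp = 0 -> [/\ lam0 = lam, lam1 = 0,
    forall B : set int, Pinf B = poissonZ lam B &
    forall B : set int, Qinf B = shifted_poissonZ lam B].
  move=> comp0; have l0 : lam0 = lam by rewrite hlam0 comp0 subr0 div1r.
  have l1 : lam1 = 0 by rewrite hlam1 comp0 mul0r.
  have PE B : Pinf B = poissonZ lam B by rewrite PS l0 l1 skellam_r0.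
  by split=> // B; rewrite QE PE.
(* Here D has the law of -J with J Poisson. The reflection sends 1 - J, the law of [Qinf], to J, and
   -J, the law of [Pinf], to 1 + J. *)
have side1 : comp = 1 -> [/\ lam0 = 0, lam1 = lam,
    forall B : set int, distribution Qinf reflz B = poissonZ lam B &
    forall B : set int, distribution Pinf reflz B = shifted_poissonZ lam B].
  move=> comp1; have l0 : lam0 = 0 by rewrite hlam0 comp1 subrr mul0r.
  have l1 : lam1 = lam by rewrite hlam1 comp1 div1r.
  have PE B : Pinf B = poissonZ lam (-%R @^-1` B) by rewrite PS l0 l1 skellam_0l.
  split=> // B.
    transitivity (Pinf (succz @^-1` (reflz @^-1` B))); first by [].
    rewrite PE; congr (poissonZ lam _).
    by apply/seteqP; split=> x /=; rewrite /reflz /succz opprB addrC subrK.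
  transitivity (Pinf (reflz @^-1` B)); first by [].
  rewrite PE; transitivity (poissonZ lam (succz @^-1` B)); last by [].
  congr (poissonZ lam _).
  by apply/seteqP; split=> x /=; rewrite /reflz /succz opprK.
split=> //.
- move=> eps _; rewrite privacy_curve_esum//.
  by apply: eq_esum => d _; rewrite Q1 pE.
- case/andP=> comp0 comp1.
  have l0 : 0 < lam0 by rewrite hlam0 divr_gt0 ?exprn_gt0 ?subr_gt0.
  have l1 : 0 < lam1 by rewrite hlam1 divr_gt0 ?exprn_gt0.
  have p0 d : 0 < p d by rewrite -lte_fin -pE PS skellam_gt0.
  split=> // -[A [k]]; apply: no_support_mismatch_floor => // d.
    by rewrite pE lte_fin.
  by rewrite Q1 lte_fin.
- exact: poisson_shift_floor.
split=> //; split=> // comp01 eps _; case: comp01 => [/side0|/side1] [_ _ E1 E2].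
  by apply: eq_two_sided_curve => B _; [exact: E1|exact: E2].
have reflzK : involutive reflz by move=> x; rewrite /reflz opprB addrC subrK.
(* The swap is needed because it is [Qinf] that reflects to the unshifted Poisson law. *)
rewrite two_sided_curveC -(two_sided_curve_distribution_involutive _ _ _ reflzK).
by apply: eq_two_sided_curve => B _; [exact: E1|exact: E2].
Qed.
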